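(* Let $V,W$ be persistence modules, let $\Phi\colon V\to W(\delta)$ be one of the two morphisms making a $\delta$-interleaving pair for $0\le\delta<\frac12\min(\Xi(V),\Xi(W))$, and let $\chi_\Phi$ be the partial matching between $\mathbf{Bar}(V)$ and $\mathbf{Bar}(W)$ induced by the ladder decomposition of $\Phi$. The cost of $\chi_\Phi$ is at most $\delta$. If further $\delta=d_I(V,W)$, then $\chi_\Phi$ realizes the bottleneck distance between $\mathbf{Bar}(V)$ and $\mathbf{Bar}(W)$.
   Context: Fix a field $\mathbb{F}$. A persistence module $V$ is a functor from $(\mathbb{R},\le)$ to $\mathbb{F}$-vector spaces, with inner morphisms $v_{s,t}\colon V_s\to V_t$ for $s\le t$, that is isomorphic to a finite direct sum of interval modules $k_J$, where $J=[i,j]$, $i\le j$, is a closed bounded interval and $k_J$ is $\mathbb{F}$ at indices in $J$, $0$ elsewhere, with identity inner morphisms inside $J$. The multiset of intervals in this decomposition is the barcode $\mathbf{Bar}(V)$; its elements are bars. A morphism $\Phi\colon V\to W$ is a family of linear maps $\Phi_t\colon V_t\to W_t$ commuting with inner morphisms. The shift $V(\delta)$ is given by $V(\delta)_t=V_{t+\delta}$, $v(\delta)_{s,t}=v_{s+\delta,t+\delta}$; for a bar $J=[i,j]$ put $J(\delta)=[i-\delta,j-\delta]$. A $\delta$-interleaving pair between $V$ and $W$ is a pair of morphisms $\Phi\colon V\to W(\delta)$, $\Psi\colon W\to V(\delta)$ with $\Psi_{t+\delta}\circ\Phi_t=v_{t,t+2\delta}$ and $\Phi_{t+\delta}\circ\Psi_t=w_{t,t+2\delta}$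 for all $t$. The interleaving distance $d_I(V,W)$ is the infimum of all $\delta\ge0$ for which a $\delta$-interleaving pair exists. Relations on intervals: $[i_1,j_1]\preceq[i_2,j_2]$ iff $i_1\le i_2\le j_1\le j_2$; $[i_1,j_1]\subset[i_2,j_2]$ (strictly nested) iff $i_2<i_1\le j_1<j_2$. Nestedness: $\Xi(V)=\min\{\min(|a-c|,|b-d|) : [a,b]\subset[c,d],\ [a,b],[c,d]\in\mathbf{Bar}(V)\}\in(0,\infty]$, equal to $\infty$ if there are no strictly nested bars. A ladder persistence module is a triple $(V,W,\Phi)$ with $\Phi\colon V\to W$ a morphism; isomorphisms are pairs of isomorphisms of the domains and codomains commuting with the morphisms; direct sums are componentwise. For $J_1\preceq J_2$, $\mathbf{R}_{J_1}^{J_2}=(k_{J_2},k_{J_1},\rho)$ with $\rho_t=\mathrm{id}$ for $t\in J_1\cap J_2$ and $0$ otherwise; $\mathbf{I}^+_J=(k_J,0,0)$; $\mathbf{I}^-_K=(0,k_K,0)$. A ladder decomposition of a morphism is an isomorphism of the corresponding triple with a finite direct sum of such elementary modules; its multiplicities are uniquely determined. Under the hypothesis $\delta<\frac12\min(\Xi(V),\Xi(W))$ a ladder decomposition of $(V,W(\delta),\Phi)$ exists. A partial matching between multisets $S_1,S_2$ is an isomorphism (multiplicity-preserving bijection, copies counted) between a sub-multiset of $S_1$ and a sub-multiset of $S_2$. The partial matching $\chi_\Phi$ induced by the ladder decomposition of $\Phi\colon V\to W(\delta)$ matches $J_V\in\mathbf{Bar}(V)$ with $J_W\in\mathbf{Bar}(W)$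 with multiplicity equal to the multiplicity of $\mathbf{R}_{J_W(\delta)}^{J_V}$ in the ladder decomposition; remaining bars are unmatched. The cost of a partial matching $\chi$ between two barcodes is the maximum of $\max(|i_1-j_1|,|i_2-j_2|)$ over matched pairs $([i_1,i_2],[j_1,j_2])$ and of $\frac12(j_2-j_1)$ over unmatched bars $[j_1,j_2]$ of either barcode. The bottleneck distance between two barcodes is the smallest cost of a partial matching between them; a matching realizes it if its cost equals this value. *)

(* Defs.v *)
From HB Require Import structures.
From mathcomp Require Import all_boot all_order all_algebra.
From mathcomp Require Import all_classical all_reals ereal.

Set Implicit Arguments.
Unset Strict Implicit.
Unset Printing Implicit Defensive.

Import Order.TTheory GRing.Theory Num.Theory.
Local Open Scope ring_scope.

Record bar (R : realType) := Bar {
  endpoints : R * R;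
  endpoints_le : endpoints.1 <= endpoints.2 }.

HB.instance Definition _ (R : realType) := [isSub for @endpoints R].
HB.instance Definition _ (R : realType) := [Choice of bar R by <:].

Section Bars.
Context (R : realType).
Implicit Types (J K : bar R) (t delta : R).

Definition lo J : R := (endpoints J).1.
Definition hi J : R := (endpoints J).2.

Definition in_bar J t : bool := lo J <= t <= hi J.

Definition bar_prec J K : bool :=
  [&& lo J <= lo K, lo K <= hi J & hi J <= hi K].

Definition bar_nested J K : bool := (lo K < lo J) && (hi J < hi K).

Lemma bar_shift_subproof delta J :
  (lo J - delta, hi J - delta).1 <= (lo J - delta, hi J - delta).2.
Proof. by rewrite /= lerD2r; exact: endpoints_le. Qed.

Definition bar_shift delta J : bar R := Bar (bar_shift_subproof delta J).

Lemma bar_shiftK delta : cancel (bar_shift delta) (bar_shift (- delta)).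
Proof.
move=> J; apply: val_inj; case: J => -[a b] h.
by rewrite /= /lo /hi /= opprK !subrK.
Qed.

End Bars.

(* Functors from (R, <=) to F-vector spaces. A persistence module is such a
   functor V together with [is_barcode V B] for some B (see below). *)

Record pfunctor (F : fieldType) (R : realType) := Pfunctor {
  space :> R -> lmodType F;
  inner : forall s t : R, s <= t -> {linear space s -> space t};
  inner_id : forall t (h : t <= t) x, inner h x = x;
  inner_comp : forall s t u (h1 : s <= t) (h2 : t <= u) (h3 : s <= u) x,
    inner h2 (inner h1 x) = inner h3 x }.

Record pmorphism (F : fieldType) (R : realType) (V W : pfunctor F R) :=
  Pmorphism {
    pmap_at :> forall t : R, {linear V t -> W t};
    pmap_natural : forall s t (h : s <= t) x,
      pmap_at t (inner V h x) = inner W h (pmap_at s x) }.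

Section PersistenceModules.
Context (F : fieldType) (R : realType).
Implicit Types (U V W : pfunctor F R) (J K : bar R) (delta : R).

Definition pm_is_iso V W (Phi : pmorphism V W) : Prop :=
  exists Psi : pmorphism W V, forall t, cancel (Phi t) (Psi t) /\
                                        cancel (Psi t) (Phi t).

Lemma shift_le delta (s t : R) : s <= t -> s + delta <= t + delta.
Proof. by rewrite lerD2r. Qed.

Lemma shift_id V delta t (h : t <= t) (x : V (t + delta)) :
  inner V (shift_le delta h) x = x.
Proof. exact: inner_id. Qed.

Lemma shift_comp V delta s t u (h1 : s <= t) (h2 : t <= u) (h3 : s <= u)
    (x : V (s + delta)) :
  inner V (shift_le delta h2) (inner V (shift_le delta h1) x) =
  inner V (shift_le delta h3) x.
Proof. exact: inner_comp. Qed.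

Definition shift delta V : pfunctor F R :=
  @Pfunctor F R (fun t => V (t + delta))
    (fun s t h => inner V (shift_le delta h))
    (@shift_id V delta) (@shift_comp V delta).

Definition zero_pm : pfunctor F R :=
  @Pfunctor F R (fun=> 'rV[F]_0) (fun _ _ _ => idfun)
    (fun _ _ _ => erefl) (fun _ _ _ _ _ _ _ => erefl).

Definition pair_map (U1 U2 V1 V2 : lmodType F) (f : {linear U1 -> V1})
  (g : {linear U2 -> V2}) (x : U1 * U2) : V1 * V2 := (f x.1, g x.2).

Lemma pair_map_linear (U1 U2 V1 V2 : lmodType F) (f : {linear U1 -> V1})
  (g : {linear U2 -> V2}) : linear (pair_map f g).
Proof. by move=> a [x1 x2] [y1 y2]; rewrite /pair_map /= !linearP. Qed.

HB.instance Definition _ (U1 U2 V1 V2 : lmodType F) (f : {linear U1 -> V1})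
    (g : {linear U2 -> V2}) :=
  GRing.isLinear.Build F (U1 * U2)%type (V1 * V2)%type _ (pair_map f g)
    (pair_map_linear f g).

Lemma dsum_id V W t (h : t <= t) (x : V t * W t) :
  pair_map (inner V h) (inner W h) x = x.
Proof. by case: x => x y; rewrite /pair_map /= !inner_id. Qed.

Lemma dsum_comp V W s t u (h1 : s <= t) (h2 : t <= u) (h3 : s <= u)
    (x : V s * W s) :
  pair_map (inner V h2) (inner W h2) (pair_map (inner V h1) (inner W h1) x) =
  pair_map (inner V h3) (inner W h3) x.
Proof. by rewrite /pair_map /= !(inner_comp h1 h2 h3). Qed.

Definition dsum_pm V W : pfunctor F R :=
  @Pfunctor F R (fun t => (V t * W t)%type)
    (fun s t h => pair_map (inner V h) (inner W h))
    (@dsum_id V W) (@dsum_comp V W).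

(* The space of k_J at t is 'rV[F]_1 or 'rV[F]_0 according to
   whether t lies in J; [bar_map J K s t] from the space of k_J at s to that of
   k_K at t is the identity when both are 'rV[F]_1, and 0 otherwise. *)

Definition bar_map J K (s t : R) :
    {linear 'rV[F]_(in_bar J s) -> 'rV[F]_(in_bar K t)} :=
  mulmxr (pid_mx 1).

Lemma bar_map_comp J1 J2 J3 s t u (x : 'rV[F]_(in_bar J1 s)) :
  (in_bar J1 s -> in_bar J3 u -> in_bar J2 t) ->
  bar_map J2 J3 t u (bar_map J1 J2 s t x) = bar_map J1 J3 s u x.
Proof.
rewrite /= -mulmxA mul_pid_mx minnn => h; congr (_ *m _); move: h {x}.
case: (in_bar J1 s) => h; last by rewrite !flatmx0.
case: (in_bar J3 u) h => h; last by rewrite !thinmx0.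
by rewrite h.
Qed.

Lemma interval_id J t (h : t <= t) (x : 'rV[F]_(in_bar J t)) :
  bar_map J J t t x = x.
Proof.
rewrite /= (_ : pid_mx 1 = 1%:M) ?mulmx1// {h x}.
by case: (in_bar J t); [exact: pid_mx_1 | rewrite !flatmx0].
Qed.

Lemma interval_comp J s t u (h1 : s <= t) (h2 : t <= u) (h3 : s <= u)
    (x : 'rV[F]_(in_bar J s)) :
  bar_map J J t u (bar_map J J s t x) = bar_map J J s u x.
Proof.
apply: bar_map_comp => /andP[Js _] /andP[_ Ju].
by rewrite /in_bar (le_trans Js) ?(le_trans _ Ju).
Qed.

Definition interval_pm J : pfunctor F R :=
  @Pfunctor F R (fun t => 'rV[F]_(in_bar J t)) (fun s t _ => bar_map J J s t)
    (@interval_id J) (@interval_comp J).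

(* Multisets are represented by sequences, considered up to [perm_eq]. *)

Definition bars_pm (B : seq (bar R)) : pfunctor F R :=
  foldr (fun J V => dsum_pm (interval_pm J) V) zero_pm B.

Definition is_barcode V (B : seq (bar R)) : Prop :=
  exists Phi : pmorphism V (bars_pm B), pm_is_iso Phi.

(* The index t + delta + delta stands for t + 2 delta: it is
   where [shift delta] lands definitionally. *)

Lemma le_shift2 delta (t : R) : 0 <= delta -> t <= t + delta + delta.
Proof. by move=> d0; rewrite -addrA lerDl addr_ge0. Qed.

Definition interleaving_pair V W delta (delta0 : 0 <= delta)
    (Phi : pmorphism V (shift delta W)) (Psi : pmorphism W (shift delta V)) :
    Prop :=
  (forall t (x : V t),
     Psi (t + delta) (Phi t x) = inner V (le_shift2 t delta0) x) /\
  (forall t (y : W t),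
     Phi (t + delta) (Psi t y) = inner W (le_shift2 t delta0) y).

Definition interleaving_distance V W : \bar R :=
  ereal_inf [set d | exists (delta : R) (delta0 : 0 <= delta)
    (Phi : pmorphism V (shift delta W)) (Psi : pmorphism W (shift delta V)),
    interleaving_pair delta0 Phi Psi /\ d = delta%:E]%classic.

Record ladder := Ladder {
  ladder_dom : pfunctor F R;
  ladder_cod : pfunctor F R;
  ladder_map : pmorphism ladder_dom ladder_cod }.

Definition ladder_iso (L M : ladder) : Prop :=
  exists (f : pmorphism (ladder_dom L) (ladder_dom M))
         (g : pmorphism (ladder_cod L) (ladder_cod M)),
    [/\ pm_is_iso f, pm_is_iso g &
        forall t x, g t (ladder_map L t x) = ladder_map M t (f t x)].

Lemma dsum_natural V1 W1 V2 W2 (f : pmorphism V1 W1) (g : pmorphism V2 W2)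
    s t (h : s <= t) (x : dsum_pm V1 V2 s) :
  pair_map (f t) (g t) (inner (dsum_pm V1 V2) h x) =
  inner (dsum_pm W1 W2) h (pair_map (f s) (g s) x).
Proof. by rewrite /pair_map /= !pmap_natural. Qed.

Definition dsum_ladder (L M : ladder) : ladder :=
  Ladder (@Pmorphism F R (dsum_pm (ladder_dom L) (ladder_dom M))
    (dsum_pm (ladder_cod L) (ladder_cod M))
    (fun t => pair_map (ladder_map L t) (ladder_map M t))
    (dsum_natural (ladder_map L) (ladder_map M))).

Lemma zero_natural V W s t (h : s <= t) (x : V s) :
  (\0 : {linear V t -> W t}) (inner V h x) =
  inner W h ((\0 : {linear V s -> W s}) x).
Proof. by rewrite /= linear0. Qed.

Definition zero_morphism V W : pmorphism V W :=
  @Pmorphism F R V W (fun=> \0) (@zero_natural V W).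

Definition zero_ladder : ladder := Ladder (zero_morphism zero_pm zero_pm).

Lemma rho_natural J1 J2 (h12 : bar_prec J1 J2) s t (h : s <= t)
    (x : interval_pm J2 s) :
  bar_map J2 J1 t t (inner (interval_pm J2) h x) =
  inner (interval_pm J1) h (bar_map J2 J1 s s x).
Proof.
case/and3P: h12 => l12 _ h12.
rewrite [LHS]bar_map_comp ?[RHS]bar_map_comp// /in_bar.
  move=> /andP[J2s _] /andP[_ J1t].
  by rewrite (le_trans l12 J2s) (le_trans h J1t).
move=> /andP[J2s _] /andP[_ J1t].
by rewrite (le_trans J2s h) (le_trans J1t h12).
Qed.

Definition rho J1 J2 (h12 : bar_prec J1 J2) :
    pmorphism (interval_pm J2) (interval_pm J1) :=
  @Pmorphism F R (interval_pm J2) (interval_pm J1)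
    (fun t => bar_map J2 J1 t t) (rho_natural h12).

End PersistenceModules.

(* Names of the elementary ladder modules: [ElemR h12], with h12 a proof of
   [bar_prec J1 J2], has domain k_(J2) and codomain k_(J1). *)

Inductive elementary (R : realType) :=
  | ElemR (J1 J2 : bar R) of bar_prec J1 J2
  | ElemPlus of bar R
  | ElemMinus of bar R.

Section LadderDecomposition.
Context (F : fieldType) (R : realType).

Definition elementary_ladder (e : elementary R) : ladder F R :=
  match e with
  | ElemR J1 J2 h12 => Ladder (rho F h12)
  | ElemPlus J => Ladder (zero_morphism (interval_pm F J) (zero_pm F R))
  | ElemMinus K => Ladder (zero_morphism (zero_pm F R) (interval_pm F K))
  end.

Definition elementary_sum (D : seq (elementary R)) : ladder F R :=
  foldr (fun e L => dsum_ladder (elementary_ladder e) L) (zero_ladder F R) D.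

Definition ladder_decomposition (V W : pfunctor F R) (Phi : pmorphism V W)
    (D : seq (elementary R)) : Prop :=
  ladder_iso (Ladder Phi) (elementary_sum D).

End LadderDecomposition.

Section Matchings.
Context (R : realType).
Implicit Types (J K : bar R) (B : seq (bar R)) (M : seq (bar R * bar R)).

Definition nestedness B : \bar R :=
  \big[Order.min/+oo%E]_(J <- B) \big[Order.min/+oo%E]_(K <- B | bar_nested J K)
    (Num.min `|lo J - lo K| `|hi J - hi K|)%:E.

Definition submultiset B1 B2 : Prop :=
  forall J, (count_mem J B1 <= count_mem J B2)%N.

(* A partial matching is recorded as the multiset of its matched pairs: the
   sub-multisets which it pairs are the two projections. *)
Definition partial_matching B1 B2 M : Prop :=
  submultiset (unzip1 M) B1 /\ submultiset (unzip2 M) B2.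

Definition matched_cost (p : bar R * bar R) : R :=
  Num.max `|lo p.1 - lo p.2| `|hi p.1 - hi p.2|.

(* B' is the multiset of matched bars of B, so J is left with an unmatched copy
   exactly when its multiplicity in B' is smaller than in B. *)
Definition unmatched_cost B' B : R :=
  \big[Num.max/0]_(J <- B | (count_mem J B' < count_mem J B)%N)
    ((hi J - lo J) / 2).

Definition matching_cost B1 B2 M : R :=
  Num.max (\big[Num.max/0]_(p <- M) matched_cost p)
    (Num.max (unmatched_cost (unzip1 M) B1) (unmatched_cost (unzip2 M) B2)).

(* There are finitely many partial matchings between B1 and B2 up to
   [perm_eq], so this infimum is a minimum. *)
Definition bottleneck_distance B1 B2 : R :=
  inf [set c | exists M, partial_matching B1 B2 M /\
                         c = matching_cost B1 B2 M]%classic.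

Definition realizes_bottleneck B1 B2 M : Prop :=
  partial_matching B1 B2 M /\
  matching_cost B1 B2 M = bottleneck_distance B1 B2.

Definition is_ElemR J1 J2 (e : elementary R) : bool :=
  if e is ElemR K1 K2 _ then (K1 == J1) && (K2 == J2) else false.

Definition multR J1 J2 (D : seq (elementary R)) : nat :=
  count (is_ElemR J1 J2) D.

(* For a ladder decomposition D of a morphism V -> W(delta); the codomain bars
   are of the form J_W(delta). *)
Definition induced_matching (delta : R) (D : seq (elementary R)) :
    seq (bar R * bar R) :=
  pmap (fun e => if e is ElemR J1 J2 _
                 then Some (J2, bar_shift (- delta) J1) else None) D.

Lemma count_induced_matching delta D JV JW :
  count_mem (JV, JW) (induced_matching delta D) =
  multR (bar_shift delta JW) JV D.
Proof.
rewrite /induced_matching /multR.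
elim: D => //= -[J1 J2 h|J|J] D /= <- //.
congr (nat_of_bool _ + _)%N; rewrite xpair_eqE andbC; congr (_ && _).
apply/eqP/eqP => [<-|->]; last exact: bar_shiftK.
by rewrite -{1}(opprK delta) bar_shiftK.
Qed.

End Matchings.

(* Main.v *)
(** The two interleaving identities say that every element of [ker Phi] dies
    after a shift by [2 delta], and that every element of the codomain lies in
    the image of [Phi] after a shift by [2 delta].  Both properties are
    inherited by the direct summands of a ladder decomposition, and on an
    elementary summand they bound by [2 delta] the differences of endpoints (for
    [R]) or the length (for [I+], [I-]).  The other half of the bounds for [R]
    is the relation [bar_prec].  The bars of the decomposition are those of [V]
    and [W(delta)], because a barcode is determined by the ranks of the inner
    morphisms.  Finally, a partial matching of cost [c] yields an interleaving
    for every [delta > c], so [d_I] is at most the bottleneck distance, and the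
    bound on the cost makes the induced matching optimal when
    [delta = d_I(V, W)]. *)

From HB Require Import structures.
Require Import Defs.
From mathcomp Require Import all_boot all_order all_algebra.
From mathcomp Require Import all_classical all_reals ereal.
From mathcomp Require Import lra.
Import Order.TTheory GRing.Theory Num.Theory.
Local Open Scope ring_scope.

Set Implicit Arguments.
Unset Strict Implicit.
Unset Printing Implicit Defensive.

(** * Ranks of linear maps between arbitrary vector spaces *)

Section Rank.
Context (F : fieldType).
Implicit Types U V : lmodType F.

(* The spaces need not be finite dimensional: the rank is n when f factors
   through F^n and the identity of F^n factors through f. *)
Definition rank_is U V (f : U -> V) (n : nat) : Prop :=
  (exists (q : U -> 'rV[F]_n) (j : 'rV[F]_n -> V),
     [/\ linear q, linear j & forall x, f x = j (q x)]) /\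
  (exists (i : 'rV[F]_n -> U) (p : V -> 'rV[F]_n),
     [/\ linear i, linear p & forall x, p (f (i x)) = x]).

Lemma linear_comp U V (W : lmodType F) (f : U -> V) (g : V -> W) :
  linear f -> linear g -> linear (g \o f).
Proof. by move=> lf lg a u v /=; rewrite lf lg. Qed.

Definition linear_pack U V (f : U -> V) (lf : linear f) : {linear U -> V} :=
  HB.pack f (GRing.isLinear.Build F U V *:%R f lf).

(** The matrices of [f] and [g] multiply to the identity of size n, whose rank n is at most the
    number m of columns of the first factor. *)
Lemma linear_cancel_leq n m (f : 'rV[F]_n -> 'rV[F]_m)
    (g : 'rV[F]_m -> 'rV[F]_n) :
  linear f -> linear g -> cancel f g -> (n <= m)%N.
Proof.
move=> lf lg fK.
have fg1 : lin1_mx (linear_pack lf) *m lin1_mx (linear_pack lg) = 1%:M.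
  by apply/row_matrixP => i; rewrite !rowE mulmxA !mul_rV_lin1 /= fK mulmx1.
by rewrite -(mxrank1 F n) -fg1 (leq_trans (mxrankM_maxl _ _))// rank_leq_col.
Qed.

(** The identity of F^n factors through [f], hence through [f'], hence through F^m. Used in both
    directions, this gives at once the uniqueness of the rank and its invariance under
    isomorphism. *)
Lemma rank_is_conj_leq U V U' V' (f : U -> V) (f' : U' -> V') n m
    (a : {linear U -> U'}) (b : {linear V' -> V}) :
  (forall x, f x = b (f' (a x))) -> rank_is f n -> rank_is f' m -> (n <= m)%N.
Proof.
move=> fE [_ [i [p [li lp pi]]]] [[q [j [lq lj jq]]] _].
apply: (@linear_cancel_leq _ _ (q \o (a \o i)) ((p \o b) \o j)).
- by apply: linear_comp => //; apply: linear_comp => // k u v; exact: linearP.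
- by apply: linear_comp => //; apply: linear_comp => // k u v; exact: linearP.
- by move=> x /=; rewrite -jq -fE pi.
Qed.

Lemma rank_is_pair (U1 U2 V1 V2 : lmodType F) (f : {linear U1 -> V1})
    (g : {linear U2 -> V2}) n m :
  rank_is f n -> rank_is g m -> rank_is (pair_map f g) (n + m).
Proof.
move=> [[q [j [lq lj jq]]] [i [p [li lp pi]]]].
move=> [[q' [j' [lq' lj' jq']]] [i' [p' [li' lp' pi']]]]; split.
- exists (fun x => row_mx (q x.1) (q' x.2)).
  exists (fun x => (j (lsubmx x), j' (rsubmx x))); split.
  + by move=> a [x1 x2] [y1 y2] /=; rewrite lq lq' -add_row_mx -scale_row_mx.
  + by move=> a x y; rewrite !linearP lj lj'.
  + by move=> x; rewrite row_mxKl row_mxKr -jq -jq'.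
- exists (fun x => (i (lsubmx x), i' (rsubmx x))).
  exists (fun x => row_mx (p x.1) (p' x.2)); split.
  + by move=> a x y; rewrite !linearP li li'.
  + by move=> a [x1 x2] [y1 y2] /=; rewrite lp lp' -add_row_mx -scale_row_mx.
  + by move=> x; rewrite /pair_map /= pi pi' hsubmxK.
Qed.

Lemma rank_is0 U V (f : U -> V) : (forall x, f x = 0) -> rank_is f 0.
Proof.
move=> f0; split.
- exists (fun=> 0), (fun=> 0); split=> // a x y; by rewrite scaler0 addr0.
- exists (fun=> 0), (fun=> 0); split=> [a x y|a x y|x].
  + by rewrite scaler0 addr0.
  + by rewrite scaler0 addr0.
  + by rewrite (thinmx0 x).
Qed.

End Rank.

(** * Ranks of inner morphisms determine the barcode *)

Section Barcodes.
Context (F : fieldType) (R : realType).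
Implicit Types (U V W : pfunctor F R) (J K : bar R) (B C : seq (bar R)).

Definition pm_iso V W : Prop := exists f : pmorphism V W, pm_is_iso f.

Lemma pm_iso_refl V : pm_iso V V.
Proof.
pose id_mor := @Pmorphism F R V V (fun=> idfun) (fun _ _ _ _ => erefl).
by exists id_mor, id_mor.
Qed.

Lemma pm_iso_sym V W : pm_iso V W -> pm_iso W V.
Proof.
by move=> [f [g fgK]]; exists g, f => t; have [] := fgK t.
Qed.

Definition pm_comp U V W (g : pmorphism V W) (f : pmorphism U V) :
    pmorphism U W.
Proof.
refine (@Pmorphism F R U W (fun t => g t \o f t) _).
by move=> s t h x /=; rewrite !pmap_natural.
Defined.

Lemma pm_iso_trans U V W : pm_iso U V -> pm_iso V W -> pm_iso U W.
Proof.
move=> [f [f' fK]] [g [g' gK]]; exists (pm_comp g f), (pm_comp f' g') => t.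
by split=> x /=; rewrite ?(gK t).1 ?(fK t).1 ?(fK t).2 ?(gK t).2.
Qed.

Lemma inner_irr V s t (h h' : s <= t) x : inner V h x = inner V h' x.
Proof. by rewrite (bool_irrelevance h h'). Qed.

(** Naturality presents each inner morphism as the other one composed with linear maps on both
    sides, which gives both inequalities. *)
Lemma rank_inner_iso V W s t (h h' : s <= t) n m :
  pm_iso V W -> rank_is (inner V h) n -> rank_is (inner W h') m -> n = m.
Proof.
move=> [f [g fgK]] rV rW; apply/eqP; rewrite eqn_leq; apply/andP; split.
- apply: (rank_is_conj_leq (a := f s) (b := g t) _ rV rW) => x.
  by rewrite (inner_irr h' h) -pmap_natural (fgK t).1.
- apply: (rank_is_conj_leq (a := g s) (b := f t) _ rW rV) => x.
  by rewrite (inner_irr h' h) -pmap_natural (fgK t).2.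
Qed.

Lemma bar_map0 J K s t (x : 'rV[F]_(in_bar J s)) :
  ~~ (in_bar J s && in_bar K t) -> bar_map F J K s t x = 0.
Proof.
rewrite /bar_map /=; case: (in_bar J s) x => x /=.
- by case: (in_bar K t) => //= _; rewrite thinmx0.
- by move=> _; rewrite (thinmx0 x) mul0mx.
Qed.

Lemma bar_map_neq0 J K s t : in_bar J s -> in_bar K t ->
  exists x : 'rV[F]_(in_bar J s), bar_map F J K s t x != 0.
Proof.
rewrite /bar_map /= => -> -> /=.
exists 1%:M; rewrite mul1mx; apply/eqP => /matrixP/(_ ord0 ord0).
by rewrite !mxE /=; apply/eqP/oner_neq0.
Qed.

Lemma rank_interval J s t (h : s <= t) :
  rank_is (inner (interval_pm F J) h) (in_bar J s && in_bar J t).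
Proof.
have [st|st] := boolP (in_bar J s && in_bar J t); last first.
  by apply: rank_is0 => x; exact: bar_map0.
have {st} : in_bar J s = true /\ in_bar J t = true by apply/andP.
rewrite /interval_pm /bar_map /=.
case: (in_bar J s) => -[// _]; case: (in_bar J t) => // _ /=.
split; exists id, id; split=> // x; by rewrite /= pid_mx_1 mulmx1.
Qed.

Lemma rank_bars_pm B s t (h : s <= t) :
  rank_is (inner (bars_pm F B) h)
    (count (fun J => in_bar J s && in_bar J t) B).
Proof.
elim: B => [|J B IH] /=; first by apply: rank_is0 => x; rewrite [LHS]thinmx0.
exact: rank_is_pair (rank_interval J h) IH.
Qed.

Lemma exists_longest_bar B : B != [::] ->
  exists2 J, J \in B & {in B, forall K, hi K - lo K <= hi J - lo J}.
Proof.
elim: B => // J [|K B] IH _.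
  by exists J => [|L]; rewrite inE // => /eqP->.
have [//|J' J'B J'max] := IH.
have [JJ'|J'J] := leP (hi J - lo J) (hi J' - lo J').
- exists J'; first by rewrite inE J'B orbT.
  by move=> L; rewrite inE => /predU1P[->|/J'max].
- exists J; first by rewrite mem_head.
  move=> L; rewrite inE => /predU1P[->//|/J'max /le_trans]; apply.
  exact: ltW.
Qed.

(* Only a copy of a bar J of maximal length can contain both endpoints of J, so
   the rank between these endpoints is the multiplicity of J. *)
Lemma perm_eq_bars_rank B C :
  (forall s t, s <= t -> count (fun J => in_bar J s && in_bar J t) B =
                         count (fun J => in_bar J s && in_bar J t) C) ->
  perm_eq B C.
Proof.
have [n] := ubnP (size B); elim: n B C => // n IH B C.
rewrite ltnS => szB eqBC.
have [E|/exists_longest_bar[J JBC Jmax]] := eqVneq (B ++ C) [::].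
  by case: (B) (C) E => [|//] [].
(* Since [J] is longest in [B ++ C], and not only in one of the two lists, the rank formula for its
   multiplicity holds for [B] and for [C]. *)
have multE E : {subset E <= B ++ C} -> count_mem J E =
    count (fun K => in_bar K (lo J) && in_bar K (hi J)) E.
  move=> sE; apply: eq_in_count => K /sE /Jmax; have := endpoints_le J.
  rewrite -/(lo J) -/(hi J) => loJ KJ /=.
  apply/eqP/idP => [->|]; first by rewrite /in_bar !lexx loJ.
  rewrite /in_bar => /andP[/andP[? ?] /andP[? ?]].
  apply: val_inj; rewrite [LHS]surjective_pairing [RHS]surjective_pairing.
  rewrite /lo /hi /= in KJ *; congr pair; apply/eqP; rewrite eq_le; apply/andP;
    split; rewrite /lo /hi in loJ *; lra.
have sB : {subset B <= B ++ C} by move=> K; rewrite mem_cat => ->.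
have sC : {subset C <= B ++ C} by move=> K; rewrite mem_cat orbC => ->.
have multBC : count_mem J B = count_mem J C.
  by rewrite !multE// eqBC//; exact: (endpoints_le J).
have JinBC : (J \in B) * (J \in C).
  move: JBC; rewrite mem_cat -!has_pred1 !has_count multBC orbb.
  by move=> ->.
(* Removing one copy of [J] from each list lowers corresponding ranks equally, so the induction
   hypothesis applies to the remainders. *)
rewrite (permPl (perm_to_rem JinBC.1)) perm_sym (permPl (perm_to_rem JinBC.2)).
rewrite perm_cons perm_sym; apply: IH.
  by rewrite size_rem ?JinBC// prednK//; case: (B) JinBC => [[]|].
move=> s t st; have := eqBC s t st.
rewrite (permP (perm_to_rem JinBC.1)) (permP (perm_to_rem JinBC.2)) /=.
by move/addnI.
Qed.

End Barcodes.

(** * Barcodes of the domain and codomain of a ladder decomposition *)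

Section LadderBars.
Context (F : fieldType) (R : realType).
Implicit Types (U V W : pfunctor F R) (J K : bar R) (B C : seq (bar R)).
Implicit Types (D : seq (elementary R)) (L M : ladder F R).

Definition dom_bars D : seq (bar R) :=
  pmap (fun e => match e with
                 | ElemR _ J _ => Some J
                 | ElemPlus J => Some J
                 | ElemMinus _ => None
                 end) D.

Definition cod_bars D : seq (bar R) :=
  pmap (fun e => match e with
                 | ElemR J _ _ => Some J
                 | ElemPlus _ => None
                 | ElemMinus J => Some J
                 end) D.

Let spans (s t : R) J := in_bar J s && in_bar J t.

Lemma rank_dom_bars D s t (h : s <= t) :
  rank_is (inner (ladder_dom (elementary_sum F D)) h)
    (count (spans s t) (dom_bars D)).
Proof.
elim: D => [|e D IH] /=; first by apply: rank_is0 => x; rewrite [LHS]thinmx0.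
case: e => [J1 J2 h12|J|J] /=.
- exact: rank_is_pair (rank_interval F J2 h) IH.
- exact: rank_is_pair (rank_interval F J h) IH.
- apply: (rank_is_pair (n := 0)) IH.
  by apply: rank_is0 => x; rewrite [LHS]thinmx0.
Qed.

Lemma rank_cod_bars D s t (h : s <= t) :
  rank_is (inner (ladder_cod (elementary_sum F D)) h)
    (count (spans s t) (cod_bars D)).
Proof.
elim: D => [|e D IH] /=; first by apply: rank_is0 => x; rewrite [LHS]thinmx0.
case: e => [J1 J2 h12|J|J] /=.
- exact: rank_is_pair (rank_interval F J1 h) IH.
- apply: (rank_is_pair (n := 0)) IH.
  by apply: rank_is0 => x; rewrite [LHS]thinmx0.
- exact: rank_is_pair (rank_interval F J h) IH.
Qed.

Lemma dom_bars_barcode V W (Phi : pmorphism V W) D B :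
  ladder_decomposition Phi D -> is_barcode V B -> perm_eq (dom_bars D) B.
Proof.
move=> [f [_ [fiso _ _]]] VB; apply: perm_eq_bars_rank => s t st.
apply: rank_inner_iso (rank_dom_bars D st) (rank_bars_pm F B st).
by apply: pm_iso_trans VB; apply: pm_iso_sym; exists f.
Qed.

Lemma pm_iso_shift V W delta :
  pm_iso V W -> pm_iso (shift delta V) (shift delta W).
Proof.
move=> [f [g fgK]].
pose sh U U' (k : pmorphism U U') := @Pmorphism F R (shift delta U)
  (shift delta U') (fun t => k (t + delta))
  (fun s t h x => pmap_natural k (shift_le delta h) x).
by exists (sh _ _ f), (sh _ _ g) => t; exact: fgK.
Qed.

Lemma cod_bars_barcode V W delta (Phi : pmorphism V (shift delta W)) D B :
  ladder_decomposition Phi D -> is_barcode W B ->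
  perm_eq (cod_bars D) (map (bar_shift delta) B).
Proof.
move=> [_ [g [_ giso _]]] WB; apply: perm_eq_bars_rank => s t st.
apply: rank_inner_iso (rank_cod_bars D st) _.
  apply: pm_iso_trans (pm_iso_shift delta WB).
  by apply: pm_iso_sym; exists g.
(* A time t lies in the shifted bar exactly when t + [delta] lies in the original one. *)
rewrite count_map /= (@eq_count _ _ (spans (s + delta) (t + delta))).
  exact: (rank_bars_pm F B (shift_le delta st)).
by move=> J; rewrite /= /spans /in_bar /lo /hi /= !lerBlDr !lerBrDr.
Qed.

End LadderBars.

(** * Small kernel and cokernel, and their meaning on elementary summands *)

Section SmallKernelCokernel.
Context (F : fieldType) (R : realType).
Implicit Types (U V W : pfunctor F R) (J K : bar R) (B C : seq (bar R)).
Implicit Types (D : seq (elementary R)) (L M : ladder F R).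

(* Writing t = s + eps as an equation avoids transports between the
   propositionally equal indices s + delta + delta and s + (delta + delta). *)
Definition small_ker_coker (eps : R) L : Prop :=
  forall s t (h : s <= t), t = s + eps ->
  (forall x, ladder_map L s x = 0 -> inner (ladder_dom L) h x = 0) /\
  (forall y, exists x, ladder_map L t x = inner (ladder_cod L) h y).

Lemma small_ker_coker_interleaving V W delta (delta0 : 0 <= delta)
    (Phi : pmorphism V (shift delta W)) (Psi : pmorphism W (shift delta V)) :
  interleaving_pair delta0 Phi Psi ->
  small_ker_coker (delta + delta) (Ladder Phi).
Proof.
move=> [PsiPhi PhiPsi] s t h; rewrite addrA => tE.
move: tE h => -> h /=; split.
- move=> x Phix; rewrite (inner_irr h (le_shift2 s delta0)) -PsiPhi.
  by rewrite Phix linear0.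
- move=> y; exists (Psi (s + delta) y); rewrite PhiPsi; exact: inner_irr.
Qed.

(** Kernel elements of [M] are pulled back to [L] along [f'], and preimages found in [L] are pushed
    forward along [f]. *)
Lemma small_ker_coker_iso eps L M :
  ladder_iso L M -> small_ker_coker eps L -> small_ker_coker eps M.
Proof.
move=> [f [g [[f' fK] [g' gK] fg]]] smallL s t h tE.
have [kerL cokerL] := smallL s t h tE.
have natM u y : ladder_map L u (f' u y) = g' u (ladder_map M u y).
  by rewrite -[LHS](gK u).1 fg (fK u).2.
split=> [x Mx0|y].
- rewrite -[x](fK s).2 -pmap_natural kerL ?linear0//.
  by rewrite natM Mx0 linear0.
- have [x Lx] := cokerL (g' s y); exists (f t x).
  by rewrite -fg Lx pmap_natural (gK s).2.
Qed.

(** The maps act componentwise, so it suffices to test on pairs with one zero entry. *)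
Lemma small_ker_coker_dsum eps L M :
  small_ker_coker eps (dsum_ladder L M) ->
  small_ker_coker eps L /\ small_ker_coker eps M.
Proof.
move=> smallLM; split=> s t h tE; have [ker coker] := smallLM s t h tE.
- split=> [x Lx|y].
    have := ker (x, 0); rewrite /= /pair_map /= Lx linear0 => /(_ erefl).
    by case.
  by have [[x x'] []] := coker (y, 0); exists x.
- split=> [x Mx|y].
    have := ker (0, x); rewrite /= /pair_map /= Mx linear0 => /(_ erefl).
    by case.
  by have [[x' x] []] := coker (0, y); exists x.
Qed.

Lemma small_ker_coker_elementary eps D :
  small_ker_coker eps (elementary_sum F D) ->
  forall e, List.In e D -> small_ker_coker eps (elementary_ladder F e).
Proof.
elim: D => //= e D IH /small_ker_coker_dsum[se sD] e' [<-//|]; exact: IH.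
Qed.

Definition elementary_close (eps : R) (e : elementary R) : Prop :=
  match e with
  | ElemR J K _ => lo K - lo J <= eps /\ hi K - hi J <= eps
  | ElemPlus J => hi J - lo J <= eps
  | ElemMinus J => hi J - lo J <= eps
  end.

Lemma small_ker_coker_close eps e : 0 <= eps ->
  small_ker_coker eps (elementary_ladder F e) -> elementary_close eps e.
Proof.
move=> eps0; case: e => [J K JK|J|J] /= small.
- have := JK; rewrite /bar_prec => /and3P[loJK loKhiJ hiJK].
  split; rewrite leNgt; apply/negP => gap.
  (* If the left endpoints were too far apart, the generator of k_J born at [lo J] would still be
     alive at [lo J + eps], where k_K is still zero and cannot reach it. *)
  + have h : lo J <= lo J + eps by rewrite lerDl.
    have [_ coker] := small _ _ h erefl.
    have [||y] := @bar_map_neq0 F R J J (lo J) (lo J + eps).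
    * by rewrite /in_bar; lra.
    * by rewrite /in_bar; lra.
    have [x xy] := coker y; move/eqP; apply; rewrite -[LHS]xy.
    by apply: bar_map0; rewrite /in_bar; lra.
  (* At [hi K - eps] the codomain k_J has already ended, so the generator of k_K lies in the kernel
     there; yet it survives until [hi K]. *)
  + have h : hi K - eps <= hi K by lra.
    have [|ker _] := small _ _ h; first by rewrite subrK.
    have [||x] := @bar_map_neq0 F R K K (hi K - eps) (hi K).
    * by rewrite /in_bar; lra.
    * by rewrite /in_bar; lra.
    move/eqP; apply; apply: ker.
    by apply: bar_map0; rewrite /in_bar; lra.
(* For I+ everything is in the kernel, but a bar longer than [eps] carries a generator from
   [hi J - eps] to [hi J]. *)
- rewrite leNgt; apply/negP => gap.
  have h : hi J - eps <= hi J by lra.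
  have [|ker _] := small _ _ h; first by rewrite subrK.
  have [||x] := @bar_map_neq0 F R J J (hi J - eps) (hi J).
  * by rewrite /in_bar; lra.
  * by rewrite /in_bar; lra.
  by move/eqP; apply; exact: ker.
(* For I- the image is zero, so the same surviving generator has no preimage. *)
- rewrite leNgt; apply/negP => gap.
  have h : hi J - eps <= hi J by lra.
  have [|_ coker] := small _ _ h; first by rewrite subrK.
  have [||y] := @bar_map_neq0 F R J J (hi J - eps) (hi J).
  * by rewrite /in_bar; lra.
  * by rewrite /in_bar; lra.
  by have [x xy] := coker y; move/eqP; apply; rewrite -[LHS]xy.
Qed.

End SmallKernelCokernel.

(** * From partial matchings to interleavings *)

Section Interleavings.
Context (F : fieldType) (R : realType).
Implicit Types (U V W : pfunctor F R) (J K : bar R) (A B C : seq (bar R)).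
Implicit Types (delta c : R) (M : seq (bar R * bar R)).

Definition interleaved delta V W : Prop :=
  exists (delta0 : 0 <= delta) (Phi : pmorphism V (shift delta W))
    (Psi : pmorphism W (shift delta V)), interleaving_pair delta0 Phi Psi.

Lemma interleaved_sym delta V W :
  interleaved delta V W -> interleaved delta W V.
Proof. by move=> [d0 [Phi [Psi [PsiPhi PhiPsi]]]]; exists d0, Psi, Phi. Qed.

Lemma interleaved_iso delta V V' W :
  pm_iso V V' -> interleaved delta V W -> interleaved delta V' W.
Proof.
move=> [f [g fgK]] [d0 [Phi [Psi [PsiPhi PhiPsi]]]]; exists d0.
exists (pm_comp Phi g).
have natPsi s t (h : s <= t) x :
    f (t + delta) (Psi t (inner W h x)) =
    inner (shift delta V') h (f (s + delta) (Psi s x)).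
  by rewrite (pmap_natural Psi) /= pmap_natural.
exists (@Pmorphism F R W (shift delta V')
  (fun t => f (t + delta) \o Psi t) natPsi).
split=> t x /=; first by rewrite PsiPhi pmap_natural (fgK t).2.
by rewrite (fgK (t + delta)).1 PhiPsi.
Qed.

Lemma interleaved_dsum delta V V' W W' :
  interleaved delta V W -> interleaved delta V' W' ->
  interleaved delta (dsum_pm V V') (dsum_pm W W').
Proof.
move=> [d0 [f [g [gf fg]]]] [d0' [f' [g' [gf' fg']]]]; exists d0.
exists (@Pmorphism F R (dsum_pm V V') (shift delta (dsum_pm W W'))
  (fun t => pair_map (f t) (f' t)) (dsum_natural f f')).
exists (@Pmorphism F R (dsum_pm W W') (shift delta (dsum_pm V V'))
  (fun t => pair_map (g t) (g' t)) (dsum_natural g g')).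
split=> t [x y] /=; rewrite /pair_map /=.
- by rewrite gf gf' (inner_irr (le_shift2 t d0') (le_shift2 t d0)).
- by rewrite fg fg' (inner_irr (le_shift2 t d0') (le_shift2 t d0)).
Qed.

Lemma interleaved_matched delta J K : matched_cost (J, K) <= delta ->
  interleaved delta (interval_pm F J) (interval_pm F K).
Proof.
rewrite /matched_cost /= ge_max !ler_norml.
move=> /andP[/andP[? ?] /andP[? ?]].
have d0 : 0 <= delta by lra.
(* Naturality is stated for an arbitrary pair of bars so that it serves both morphisms. The bounds
   ensure that the intermediate bar is alive whenever the source and target bars are. *)
have nat J' K' : lo K' - lo J' <= delta -> hi K' - hi J' <= delta ->
    hi J' - hi K' <= delta ->
    forall s t (h : s <= t) x,
  bar_map F J' K' t (t + delta) (inner (interval_pm F J') h x) =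
  inner (shift delta (interval_pm F K')) h (bar_map F J' K' s (s + delta) x).
  move=> ? ? ? s t h x; rewrite [LHS]bar_map_comp ?[RHS]bar_map_comp//.
    by rewrite /in_bar => /andP[? ?] /andP[? ?]; lra.
  by rewrite /in_bar => /andP[? ?] /andP[? ?]; lra.
have natJK := nat J K _ _ _; have natKJ := nat K J _ _ _.
exists d0, (@Pmorphism F R (interval_pm F J) (shift delta (interval_pm F K))
  (fun t => bar_map F J K t (t + delta))
  (natJK ltac:(lra) ltac:(lra) ltac:(lra))).
exists (@Pmorphism F R (interval_pm F K) (shift delta (interval_pm F J))
  (fun t => bar_map F K J t (t + delta))
  (natKJ ltac:(lra) ltac:(lra) ltac:(lra))).
by split=> t x; apply: bar_map_comp; rewrite /in_bar;
  move=> /andP[? ?] /andP[? ?]; lra.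
Qed.

(** The bar is shorter than 2 [delta], so its inner morphisms over 2 [delta] vanish and zero
    morphisms interleave. *)
Lemma interleaved_zero delta J : 0 <= delta -> (hi J - lo J) / 2 < delta ->
  interleaved delta (interval_pm F J) (zero_pm F R).
Proof.
move=> d0 ltd; exists d0, (zero_morphism _ _), (zero_morphism _ _).
split=> t x; last by rewrite [LHS]thinmx0 [RHS]thinmx0.
apply/esym; apply: bar_map0; rewrite /in_bar; lra.
Qed.

Lemma dsum_zero_pm V : pm_iso (dsum_pm (zero_pm F R) V) V.
Proof.
pose f t : {linear dsum_pm (zero_pm F R) V t -> V t} := snd.
pose g t (x : V t) : dsum_pm (zero_pm F R) V t := (0, x).
have lg t : linear (g t).
  by move=> a x y; rewrite /g; congr pair; rewrite [RHS]thinmx0.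
pose gl t := linear_pack (lg t).
have natf s t (h : s <= t) x : f t (inner _ h x) = inner V h (f s x) by [].
have natg s t (h : s <= t) x :
  gl t (inner V h x) = inner (dsum_pm (zero_pm F R) V) h (gl s x) by [].
exists (Pmorphism natf), (Pmorphism natg) => t.
by split=> //= -[x y]; rewrite /g /=; congr pair; rewrite [RHS]thinmx0.
Qed.

Lemma dsum_pm_iso V V' W : pm_iso V V' -> pm_iso (dsum_pm W V) (dsum_pm W V').
Proof.
move=> [f [g fgK]].
pose id_mor := @Pmorphism F R W W (fun=> idfun) (fun _ _ _ _ => erefl).
exists (@Pmorphism F R (dsum_pm W V) (dsum_pm W V') _ (dsum_natural id_mor f)).
exists (@Pmorphism F R (dsum_pm W V') (dsum_pm W V) _ (dsum_natural id_mor g)).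
move=> t; split=> -[x y]; rewrite /pair_map /=.
- by congr pair; exact: (fgK t).1.
- by congr pair; exact: (fgK t).2.
Qed.

Lemma dsum_pm_swap U V W :
  pm_iso (dsum_pm U (dsum_pm V W)) (dsum_pm V (dsum_pm U W)).
Proof.
pose f U V t (x : dsum_pm U (dsum_pm V W) t) : dsum_pm V (dsum_pm U W) t :=
  (x.2.1, (x.1, x.2.2)).
have lf U' V' t : linear (@f U' V' t) by move=> a [x [y z]] [x' [y' z']].
pose fl U V t := linear_pack (lf U V t).
have natf U' V' s t (h : s <= t) x :
  fl U' V' t (inner _ h x) = inner _ h (fl U' V' s x) by [].
exists (Pmorphism (natf U V)), (Pmorphism (natf V U)) => t.
by split=> -[x [y z]].
Qed.

Lemma bars_pm_perm A B : perm_eq A B -> pm_iso (bars_pm F A) (bars_pm F B).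
Proof.
elim: A B => [|J A IH] B pAB.
  by move: pAB; rewrite perm_sym => /perm_nilP ->; exact: pm_iso_refl.
have JB : J \in B by rewrite -(perm_mem pAB) mem_head.
have {}pAB : perm_eq A (rem J B).
  by rewrite -(perm_cons J); apply: (perm_trans pAB); exact: perm_to_rem.
apply: pm_iso_trans (dsum_pm_iso _ (IH _ pAB)) _.
(* What remains is to slide the leading [J] past the other summands to its place in [B], by
   successive swaps. *)
elim: {IH A pAB} B JB => // K B IH; rewrite inE /= eq_sym.
case: eqVneq => [-> _|_ /= JB]; first exact: pm_iso_refl.
apply: pm_iso_trans (dsum_pm_swap _ _ _) _.
exact: dsum_pm_iso (IH JB).
Qed.

(** A zero summand is added to the other side for each bar of [A], and the bar is interleaved with
    it. *)
Lemma interleaved_unmatched delta A B C :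
  {in A, forall J, (hi J - lo J) / 2 < delta} ->
  interleaved delta (bars_pm F B) (bars_pm F C) ->
  interleaved delta (bars_pm F (A ++ B)) (bars_pm F C).
Proof.
elim: A => //= J A IH Adelta BC; apply: interleaved_sym.
apply: interleaved_iso (dsum_zero_pm _) _; apply: interleaved_sym.
apply: interleaved_dsum.
  by apply: interleaved_zero; [case: BC|exact/Adelta/mem_head].
by apply: IH => // K KA; apply: Adelta; rewrite inE KA orbT.
Qed.

Lemma interleaved_nil delta : 0 <= delta ->
  interleaved delta (zero_pm F R) (zero_pm F R).
Proof.
move=> d0; exists d0, (zero_morphism _ _), (zero_morphism _ _).
by split=> t x; rewrite [LHS]thinmx0 [RHS]thinmx0.
Qed.

(** [C] is the multiset difference. The condition on its members is the one indexing the maximum in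
    [unmatched_cost], which therefore bounds every bar of [C]. *)
Lemma submultiset_perm A B : submultiset A B ->
  exists2 C, perm_eq B (A ++ C) &
             {in C, forall J, (J \in B) && (count_mem J A < count_mem J B)%N}.
Proof.
move=> sAB.
have [C pB] : exists C, perm_eq B (A ++ C).
  elim: A B sAB => [|J A IH] B sAB; first by exists B.
  have JB : J \in B.
    by rewrite -has_pred1 has_count (leq_trans _ (sAB J))//= eqxx.
  have [|C pC] := IH (rem J B).
    move=> K; rewrite -(leq_add2l (J == K)).
    by have := sAB K; rewrite (permP (perm_to_rem JB)).
  exists C; rewrite (permPl (perm_to_rem JB)) /= perm_cons//.
exists C => // J JC; rewrite (perm_mem pB) mem_cat JC orbT /=.
rewrite (permP pB) count_cat -{1}[count _ A]addn0 ltn_add2l.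
by rewrite -has_count has_pred1.
Qed.

Lemma matching_cost_ge0 B C M : 0 <= matching_cost B C M.
Proof.
rewrite le_max; apply/orP; left.
by apply: (big_ind (fun x => 0 <= x)) => // [x y x0 y0|p _];
  rewrite /matched_cost le_max ?x0 ?normr_ge0.
Qed.

(* Strictness cannot be dropped: an unmatched closed bar of length exactly
   2 delta is not killed by the shift by 2 delta. *)
Lemma interleaved_matching V W B C M delta :
  is_barcode V B -> is_barcode W C -> partial_matching B C M ->
  matching_cost B C M < delta -> interleaved delta V W.
Proof.
move=> VB WC [/submultiset_perm[B' pB B'unm] /submultiset_perm[C' pC C'unm]].
move=> cost_lt; have d0 : 0 <= delta.
  by rewrite (le_trans (matching_cost_ge0 B C M))// ltW.
move: cost_lt; rewrite !gt_max => /andP[Mdelta /andP[Bdelta Cdelta]].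
apply: (@interleaved_iso _ (bars_pm F (unzip1 M ++ B'))).
  apply: pm_iso_sym; apply: pm_iso_trans VB _; exact: bars_pm_perm.
apply/interleaved_sym/(@interleaved_iso _ (bars_pm F (unzip2 M ++ C'))).
  apply: pm_iso_sym; apply: pm_iso_trans WC _; exact: bars_pm_perm.
(* The unmatched bars are brought to the front and discarded, first on the side of [W], then on that
   of [V]; the matched pairs are left in parallel order. *)
apply: interleaved_iso (bars_pm_perm (permEl (perm_catC _ _))) _.
apply: interleaved_unmatched.
  move=> J /C'unm/andP[JC mJ]; apply: le_lt_trans Cdelta.
  exact: (le_bigmax_seq 0 _ _ (fun J => (hi J - lo J) / 2) JC mJ).
apply: interleaved_sym.
apply: interleaved_iso (bars_pm_perm (permEl (perm_catC _ _))) _.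
apply: interleaved_unmatched.
  move=> J /B'unm/andP[JB mJ]; apply: le_lt_trans Bdelta.
  exact: (le_bigmax_seq 0 _ _ (fun J => (hi J - lo J) / 2) JB mJ).
have {}Mdelta : {in M, forall p, matched_cost p <= delta}.
  by move=> p pM; apply/ltW/(le_lt_trans _ Mdelta); exact: le_bigmax_seq.
elim: {pB B'unm pC C'unm Bdelta Cdelta} M Mdelta => [_|[J K] M IH Mdelta] /=.
  exact: interleaved_nil.
apply: interleaved_dsum; first exact/interleaved_matched/Mdelta/mem_head.
by apply: IH => p pM; apply: Mdelta; rewrite inE pM orbT.
Qed.

End Interleavings.

(** * Matched and unmatched bars of the induced matching *)

Section InducedMatching.
Context (R : realType) (delta : R) (D : seq (elementary R)).

Lemma unzip1_induced_leq J :
  (count_mem J (unzip1 (induced_matching delta D)) <=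
   count_mem J (dom_bars D))%N.
Proof.
rewrite /induced_matching; elim: D => //= -[J1 J2 h|K|K] E /= IH //.
- by rewrite leq_add2l.
- by rewrite (leq_trans IH)// leq_addl.
Qed.

Lemma unzip2_induced_leq J :
  (count_mem J (unzip2 (induced_matching delta D)) <=
   count_mem J (map (bar_shift (- delta)) (cod_bars D)))%N.
Proof.
rewrite /induced_matching; elim: D => //= -[J1 J2 h|K|K] E /= IH //.
- by rewrite leq_add2l.
- by rewrite (leq_trans IH)// leq_addl.
Qed.

(** Among the summands contributing to [dom_bars], only those of type I+ are dropped by the
    matching, so a missing copy of [J] comes from one of them. *)
Lemma unzip1_induced_lt J :
  (count_mem J (unzip1 (induced_matching delta D)) <
   count_mem J (dom_bars D))%N -> List.In (ElemPlus J) D.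
Proof.
rewrite /induced_matching; elim: D => //= -[J1 J2 h|K|K] E /= IH.
- by rewrite ltn_add2l => /IH; right.
- by have [->|_ /IH] := eqVneq K J; [left|right].
- by move=> /IH; right.
Qed.

Lemma unzip2_induced_lt J :
  (count_mem J (unzip2 (induced_matching delta D)) <
   count_mem J (map (bar_shift (- delta)) (cod_bars D)))%N ->
  exists2 K, List.In (ElemMinus K) D & J = bar_shift (- delta) K.
Proof.
rewrite /induced_matching; elim: D => //= -[J1 J2 h|K|K] E /= IH.
- by rewrite ltn_add2l => /IH[K]; exists K => //; right.
- by move=> /IH[L]; exists L => //; right.
- have [<- _|_ /IH[L]] := eqVneq (bar_shift (- delta) K) J.
    by exists K => //; left.
  by exists L => //; right.
Qed.

Lemma mem_induced p : p \in induced_matching delta D ->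
  exists J1 J2 (h : bar_prec J1 J2),
    List.In (ElemR h) D /\ p = (J2, bar_shift (- delta) J1).
Proof.
rewrite /induced_matching; elim: D => //= -[J1 J2 h|K|K] E /= IH.
- rewrite inE => /predU1P[->|/IH[K1 [K2 [hK [KE ->]]]]].
    by exists J1, J2, h; split=> //; left.
  by exists K1, K2, hK; split=> //; right.
- by move=> /IH[K1 [K2 [hK [KE ->]]]]; exists K1, K2, hK; split=> //; right.
- by move=> /IH[K1 [K2 [hK [KE ->]]]]; exists K1, K2, hK; split=> //; right.
Qed.

End InducedMatching.

(** * Cost bound and optimality of the induced matching *)

Theorem corollary5p2 (F : fieldType) (R : realType) (V W : pfunctor F R)
    (BV BW : seq (bar R)) (delta : R) (delta0 : 0 <= delta)
    (Phi : pmorphism V (shift delta W)) (D : seq (elementary R)) :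
  is_barcode V BV -> is_barcode W BW ->
  (delta%:E <
     (2^-1)%:E * Order.min (nestedness BV) (nestedness BW))%E ->
  (exists Psi : pmorphism W (shift delta V),
     interleaving_pair delta0 Phi Psi) ->
  ladder_decomposition Phi D ->
  let chi := induced_matching delta D in
  [/\ partial_matching BV BW chi,
      matching_cost BV BW chi <= delta &
      delta%:E = interleaving_distance V W -> realizes_bottleneck BV BW chi].
Proof.
move=> VBV WBW _ [Psi PhiPsi] LD chi.
have pdom : perm_eq (dom_bars D) BV := dom_bars_barcode LD VBV.
(* Codomain bars of [D] are bars of W([delta]); shifting by [- delta] recovers those of [W]. *)
have pcod : perm_eq (map (bar_shift (- delta)) (cod_bars D)) BW.
  have := perm_map (bar_shift (- delta)) (cod_bars_barcode LD WBW).
  by rewrite -map_comp (eq_map (bar_shiftK delta)) map_id.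
have closeD e : List.In e D -> elementary_close (delta + delta) e.
  move=> eD; apply: (small_ker_coker_close (F := F)); first exact: addr_ge0.
  apply: small_ker_coker_elementary eD; apply: small_ker_coker_iso LD _.
  exact: small_ker_coker_interleaving PhiPsi.
have chiP : partial_matching BV BW chi.
  split=> J; first by rewrite -(permP pdom) unzip1_induced_leq.
  by rewrite -(permP pcod) unzip2_induced_leq.
have chi_delta : matching_cost BV BW chi <= delta.
  rewrite !ge_max /unmatched_cost.
  apply/and3P; split; rewrite big_seq_cond; apply: bigmax_le => //.
  (* The endpoints of [J2] exceed those of [J1] by an amount in [0, 2 [delta]]. Moving [J1] right by
     [delta] recenters the differences to [-[delta], [delta]]. *)
  - move=> p /andP[/mem_induced[J1 [J2 [h [/closeD /= [? ?] ->]]]] _].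
    move: h; rewrite /bar_prec => /and3P[? ? ?].
    rewrite /matched_cost ge_max !ler_norml /= /lo /hi /=.
    rewrite -!/(lo _) -!/(hi _); lra.
  (* Unmatched bars have length at most 2 [delta], and their cost is half of it. *)
  - move=> J /andP[_]; rewrite -(permP pdom).
    by move=> /unzip1_induced_lt/closeD /=; lra.
  - move=> J /andP[_]; rewrite -(permP pcod).
    move=> /unzip2_induced_lt[K /closeD /=].
    move=> ? ->; rewrite /lo /hi /= -/(lo _) -/(hi _); lra.
split=> // dI; split=> //; apply/eqP; rewrite eq_le; apply/andP; split.
- apply: (le_trans chi_delta); apply: lb_le_inf.
    by exists (matching_cost BV BW chi), chi.
  (* Any positive [e] gives the strict inequality needed to interleave at the cost of [M] plus [e];
     hence d_I, which is [delta], is at most the cost of [M]. *)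
  move=> _ [M [MP ->]]; apply/ler_addgt0Pr => e e0.
  have [d0' [f [g fg]]] : interleaved (matching_cost BV BW M + e) V W.
    by apply: interleaved_matching MP _ => //; rewrite ltrDl.
  rewrite -lee_fin dI; apply: ereal_inf_lbound.
  by exists (matching_cost BV BW M + e), d0', f, g.
- apply: ge_inf; last by exists chi.
  by exists 0 => _ [M [_ ->]]; exact: matching_cost_ge0.
Qed.
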